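(* For integers $l\geq 1$, $k\geq 0$ let $\rho_{l,k}=\lim_{n\to\infty}\frac{p_{n;\leq n-k}^l}{(n+1)^{n-2}}$. Then for every $k\geq 1$ $$\rho_{l,k}=\rho_{l,k-1}-\sum_{i=1}^k\frac{e^{-i}}{i!}\rho_{l,k-i},$$ and $\rho_{l,k}=\rho_{l,0}\sum_{i=0}^k\frac{(-1)^i(k+1-i)^i}{i!}e^{-i}$. With $\rho_l(x)=\sum_{k\geq 0}\rho_{l,k}x^k$ one has $\rho_{l}(x)=\rho_{l,0}\left(e^{x/e}-x\right)^{-1}$, and with $\rho(x,y)=\sum_{l\geq 1}\rho_l(x)y^l$, $$\rho(x,y)=\frac{\frac{y^2}{e}P\!\left(\frac{y}{e}\right)-2y}{(y-1)\left(e^{x/e}-x\right)}.$$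
   Context: There are $n$ parking spaces in a line numbered $1,\dots,n$; $n$ cars arrive in order, car $j$ has preference $a_j\in[n]$ and parks in the first unoccupied space numbered $\geq a_j$, if any; $(a_1,\dots,a_n)$ is a parking function if all cars park. $p_{n;\leq s}^l$ is the number of parking functions of length $n$ with $a_1=l$ and all $a_j\leq s$. $P(x)=\sum_{n\geq 0}\frac{(n+1)^{n-1}}{n!}x^n$. *)

(* Defs.v *)
From HB Require Import structures.
From mathcomp Require Import all_boot all_order all_algebra.
From mathcomp Require Import all_classical all_reals all_analysis.

Set Implicit Arguments.
Unset Strict Implicit.
Unset Printing Implicit Defensive.

Import Order.TTheory GRing.Theory Num.Theory.
Import numFieldNormedType.Exports.

Local Open Scope ring_scope.

(** * Parking functions *)

(* The first space numbered >= p, among the spaces 1, ..., n, that is not in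
   the list occ of occupied spaces, if there is one. *)
Definition first_free (n : nat) (occ : seq nat) (p : nat) : option nat :=
  ohead [seq s <- iota p (n.+1 - p) | s \notin occ].

(* The cars with preferences prefs arrive in order; occ is the list of the
   spaces that are already occupied. *)
Fixpoint all_cars_park (n : nat) (occ prefs : seq nat) : bool :=
  if prefs is p :: prefs' then
    if first_free n occ p is Some s then all_cars_park n (s :: occ) prefs'
    else false
  else true.

Definition parking_function (n : nat) (prefs : seq nat) : bool :=
  all_cars_park n [::] prefs.

(* Ordinals start at 0 and spaces at 1: i : 'I_n stands for the space i.+1. *)
Definition preferences (n : nat) (a : n.-tuple 'I_n) : seq nat :=
  [seq (val i).+1 | i <- a].

(* The number of parking functions (a_1, ..., a_n) with a_1 = l and a_j <= s
   for all j. *)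
Definition num_parking (n s l : nat) : nat :=
  #|[set a : n.-tuple 'I_n |
      [&& parking_function n (preferences a),
          ohead (preferences a) == Some l
        & all (fun p => (p <= s)%N) (preferences a)]]|.

(** * Formal power series in one variable *)

Record fps (A : Type) := Fps { fps_coef : nat -> A }.

Section FpsRing.
Variable A : comNzRingType.
Implicit Types f g h : fps A.

HB.instance Definition _ := gen_eqMixin (fps A).
HB.instance Definition _ := gen_choiceMixin (fps A).

Lemma fpsP f g : (forall n, fps_coef f n = fps_coef g n) -> f = g.
Proof. by case: f g => [f] [g] /= fg; congr Fps; apply/funext. Qed.

Definition fps_zero : fps A := Fps (fun=> 0).
Definition fps_opp f : fps A := Fps (fun n => - fps_coef f n).
Definition fps_add f g : fps A := Fps (fun n => fps_coef f n + fps_coef g n).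

Lemma fps_addA : associative fps_add.
Proof. by move=> f g h; apply: fpsP => n /=; rewrite addrA. Qed.

Lemma fps_addC : commutative fps_add.
Proof. by move=> f g; apply: fpsP => n /=; rewrite addrC. Qed.

Lemma fps_add0 : left_id fps_zero fps_add.
Proof. by move=> f; apply: fpsP => n /=; rewrite add0r. Qed.

Lemma fps_addN : left_inverse fps_zero fps_opp fps_add.
Proof. by move=> f; apply: fpsP => n /=; rewrite addNr. Qed.

HB.instance Definition _ :=
  GRing.isZmodule.Build (fps A) fps_addA fps_addC fps_add0 fps_addN.

Definition fpsC (c : A) : fps A := Fps (fun n => if n == 0%N then c else 0).

Definition fps_mul f g : fps A :=
  Fps (fun n => \sum_(i < n.+1) fps_coef f i * fps_coef g (n - i)).

Let tr N f : {poly A} := \poly_(i < N.+1) fps_coef f i.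

Let coef_tr N f n : (n <= N)%N -> (tr N f)`_n = fps_coef f n.
Proof. by move=> nN; rewrite coef_poly ltnS nN. Qed.

Let coef_mul N f g n : (n <= N)%N ->
  fps_coef (fps_mul f g) n = (tr N f * tr N g)`_n.
Proof.
move=> nN; rewrite coefM /=; apply: eq_bigr => -[i /=]; rewrite ltnS => le_in _.
by rewrite !coef_tr // ?(leq_trans (leq_subr _ _)) // (leq_trans le_in).
Qed.

Lemma fps_mulC : commutative fps_mul.
Proof. by move=> f g; apply: fpsP => n; rewrite !(@coef_mul n) // mulrC. Qed.

Lemma fps_mulA : associative fps_mul.
Proof.
have mulE f g h n :
    fps_coef (fps_mul (fps_mul f g) h) n = (tr n f * tr n g * tr n h)`_n.
  rewrite coefM /=; apply: eq_bigr => -[i /=]; rewrite ltnS => le_in _.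
  by rewrite -(coef_mul _ _ le_in) (@coef_tr n) // leq_subr.
move=> f g h; apply: fpsP => n; rewrite fps_mulC !mulE.
by rewrite mulrC mulrA.
Qed.

Lemma fps_mul1 : left_id (fpsC 1) fps_mul.
Proof.
move=> f; apply: fpsP => n /=; rewrite big_ord_recl /= subn0 mul1r.
by rewrite big1 ?addr0 // => i _; rewrite mul0r.
Qed.

Lemma fps_mulDl : left_distributive fps_mul fps_add.
Proof.
move=> f g h; apply: fpsP => n /=; rewrite -big_split /=.
by apply: eq_bigr => i _; rewrite mulrDl.
Qed.

Lemma fps_oner_neq0 : fpsC 1 != fps_zero.
Proof.
apply/eqP => /(congr1 (fun f => fps_coef f 0)) /= /eqP.
by rewrite oner_eq0.
Qed.

HB.instance Definition _ := GRing.Zmodule_isComNzRing.Build (fps A)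
  fps_mulA fps_mulC fps_mul1 fps_mulDl fps_oner_neq0.

Definition fps_unit : {pred fps A} := fun f => `[< exists g, g * f = 1 >].
Definition fps_inv f : fps A := xget f [set g | g * f = 1]%classic.

Lemma fps_mulV : {in fps_unit, left_inverse 1 fps_inv *%R}.
Proof.
move=> f /asboolP [g gf].
by apply: (@xgetPex _ f [set g | g * f = 1]%classic); exists g.
Qed.

Lemma fps_unitPl f g : g * f = 1 -> f \in fps_unit.
Proof. by move=> gf; apply/asboolP; exists g. Qed.

Lemma fps_inv_out : {in [predC fps_unit], fps_inv =1 id}.
Proof.
move=> f /negP fN; apply: xgetPN => g /= gf; apply: fN.
exact: fps_unitPl gf.
Qed.

HB.instance Definition _ := GRing.ComNzRing_hasMulInverse.Build (fps A)
  fps_mulV fps_unitPl fps_inv_out.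

Definition fpsX : fps A := Fps (fun n => (n == 1%N)%:R).

(* The substitution f(cX). *)
Definition fps_dilate (c : A) f : fps A :=
  Fps (fun n => c ^+ n * fps_coef f n).

End FpsRing.

Arguments fpsX {A}.

(* In fps (fps A) the coefficients are series in the variable x and the outer
   variable is y: for f : fps A, fpsC f is the series f(x), fps_lift f is f(y),
   and fpsX is y. *)
Definition fps_lift (A : comNzRingType) (f : fps A) : fps (fps A) :=
  Fps (fun n => fpsC (fps_coef f n)).

Lemma fps_unitE (A : comUnitRingType) (f : fps A) :
  (f \is a GRing.unit) = (fps_coef f 0 \is a GRing.unit).
Proof.
apply/idP/idP => [/mulVr /(congr1 (fun h => fps_coef h 0)) /= | f0].
  by rewrite big_ord1 subn0 => gf; apply/unitrPr; exists (fps_coef f^-1 0);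
     rewrite mulrC.
pose next m (t : seq A) :=
  (fps_coef f 0)^-1 * ((m == 0%N)%:R - \sum_(i < m) t`_i * fps_coef f (m - i)).
pose fix s n : seq A := if n is m.+1 then rcons (s m) (next m (s m)) else [::].
pose g n := (s n.+1)`_n.
have size_s n : size (s n) = n by elim: n => //= n IHn; rewrite size_rcons IHn.
have sE n i : (i < n)%N -> (s n)`_i = g i.
  elim: n => // n IHn; rewrite ltnS leq_eqVlt => /predU1P[-> // | lt_in].
  by rewrite /= nth_rcons size_s lt_in IHn.
have gE n :
    g n * fps_coef f 0 = (n == 0%N)%:R - \sum_(i < n) g i * fps_coef f (n - i).
  rewrite {1}/g /= nth_rcons size_s ltnn eqxx /next mulrC mulVKr //.
  by congr (_ - _); apply: eq_bigr => i _; rewrite sE.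
apply/unitrPr; exists (Fps g); rewrite mulrC; apply: fpsP => n /=.
by rewrite big_ord_recr /= subnn gE addrC subrK; case: eqP.
Qed.

(** * The asymptotic quantities *)

Section Rho.
Variable R : realType.

Definition rho_seq (l k n : nat) : R :=
  (num_parking n (n - k) l)%:R / (n.+1%:R : R) ^ (n%:Z - 2).

Definition rho (l k : nat) : R := limn (rho_seq l k).

Definition rho_gf (l : nat) : fps R := Fps (rho l).

(* rho(x, y), summed over l >= 1. *)
Definition rho_gf2 : fps (fps R) :=
  Fps (fun l => if l == 0%N then 0 else rho_gf l).

Definition fps_exp : fps R := Fps (fun n => (n`!%:R)^-1).

Definition fps_P : fps R :=
  Fps (fun n => (n.+1%:R : R) ^ (n%:Z - 1) / n`!%:R).

(* e^(x/e) - x *)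
Definition exp_sub_x : fps R := fps_dilate (expR 1)^-1 fps_exp - fpsX.

Lemma exp_sub_x_unit : exp_sub_x \is a GRing.unit.
Proof. by rewrite fps_unitE /= expr0 mul1r fact0 invr1 subr0 unitr1. Qed.

Lemma rho_gf2_denom_unit :
  (fpsX - 1) * fpsC exp_sub_x \is a @GRing.unit (fps (fps R)).
Proof.
rewrite unitrM [X in X && _]fps_unitE [X in _ && X]fps_unitE /=.
by rewrite exp_sub_x_unit andbT add0r unitrN unitr1.
Qed.

End Rho.

(* Main.v *)
Require Import Defs.
From HB Require Import structures.
From mathcomp Require Import all_boot all_order all_algebra.
From mathcomp Require Import all_classical all_reals all_analysis.
From mathcomp Require Import ring zify.

Set Implicit Arguments.
Unset Strict Implicit.
Unset Printing Implicit Defensive.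

Import Order.TTheory GRing.Theory Num.Theory.
Import numFieldNormedType.Exports.

(** A word is a parking function iff, for every t, at most n - t cars prefer a
    space beyond t.  This condition is compatible with splitting a word into the
    subword of its letters in a set and the subword of the other letters, which
    gives three recursions:
    - splitting off the cars that prefer the first space, a binomial recursion
      for m cars on n spaces, solved by (n+1-m)(n+1)^(m-1);
    - splitting at l, the difference of the numbers of parking functions with
      a_1 = l and with a_1 = l+1, namely
      C(n-1,l-1) l^(l-2) (n+1-l)^(n-l-1);
    - splitting off the cars that prefer the largest allowed space n-k+1,
      p_(n;<=n-k+1)^l = sum_(i<=k) C(n-1,i) p_(n-i;<=n-k)^l.
    After division by (n+1)^(n-2) the coefficients converge by
    (1 - i/n)^n -> e^(-i), so the last recursion becomes the recurrence for
    rho_(l,k), that is (e^(x/e) - x) rho_l(x) = rho_(l,0); the explicit formula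
    is the geometric expansion of 1/(e^(x/e) - x), and the second recursion
    telescopes to the generating function of the rho_(l,0). *)

(** * Counting words over a finite alphabet *)

Local Open Scope nat_scope.

(** The recursion absorbs the first letter into the predicate, so inductions on the length run with
    [P] generalised. *)
Fixpoint num_words (s : seq nat) (m : nat) (P : pred (seq nat)) : nat :=
  if m is m'.+1 then \sum_(a <- s) num_words s m' (fun w => P (a :: w))
  else P [::].

Implicit Types (w : seq nat) (P Q : pred (seq nat)).

Lemma num_wordsS (s : seq nat) m P :
  num_words s m.+1 P = \sum_(a <- s) num_words s m (fun w => P (a :: w)).
Proof. by []. Qed.

Lemma eq_num_words (s : seq nat) m P Q :
  (forall w, size w = m -> all (mem s) w -> P w = Q w) ->
  num_words s m P = num_words s m Q.
Proof.
elim: m P Q => [|m IHm] P Q PQ /=; first by rewrite PQ.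
apply: eq_big_seq => a sa; apply: IHm => w sz_w sw.
by apply: PQ; rewrite /= ?sz_w // sw andbT.
Qed.

Lemma num_words0 (s : seq nat) m P :
  (forall w, size w = m -> all (mem s) w -> P w = false) -> num_words s m P = 0.
Proof.
elim: m P => [|m IHm] P P0 /=; first by rewrite P0.
rewrite big_seq big1 // => a sa; apply: IHm => w sz_w sw.
by apply: P0; rewrite /= ?sz_w // sw andbT.
Qed.

Lemma num_wordsD (s : seq nat) m (P Q R : pred (seq nat)) :
  (forall w, size w = m -> all (mem s) w -> P w = (Q w + R w)%N :> nat) ->
  num_words s m P = num_words s m Q + num_words s m R.
Proof.
elim: m P Q R => [|m IHm] P Q R PQR /=; first by rewrite PQR.
rewrite -big_split; apply: eq_big_seq => a sa; apply: IHm => w sz_w sw.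
by apply: PQR; rewrite /= ?sz_w // sw andbT.
Qed.

Lemma num_words_map (f : nat -> nat) (s : seq nat) m P :
  num_words (map f s) m P = num_words s m (fun w => P (map f w)).
Proof.
elim: m P => //= m IHm P; rewrite big_map.
by apply: eq_bigr => a _; rewrite IHm.
Qed.

Lemma num_words_filter (p : pred nat) (s : seq nat) m P :
  (forall w, P w -> all p w) -> num_words (seq.filter p s) m P =
    num_words s m P.
Proof.
elim: m P => //= m IHm P Pp; rewrite big_filter big_mkcond /=.
apply: eq_bigr => a _; case: ifP => [pa | pNa].
  by apply: IHm => w /Pp /andP[].
by rewrite num_words0 // => w _ _; apply/negP => /Pp /=; rewrite pNa.
Qed.

Lemma num_words_nseq a m P : num_words [:: a] m P = P (nseq m a).
Proof. by elim: m P => //= m IHm P; rewrite big_seq1 IHm. Qed.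

(* A word is the shuffle of its letters in p and its letters outside p. *)
Lemma num_words_shuffle (p : pred nat) (s : seq nat) m P Q :
  num_words s m (fun w => P (seq.filter p w) && Q (seq.filter (predC p) w)) =
  \sum_(j < m.+1) 'C(m, j) *
    (num_words (seq.filter p s) j P *
      num_words (seq.filter (predC p) s) (m - j) Q).
Proof.
elim: m P Q => [|m IHm] P Q /=.
  by rewrite big_ord1 /= bin0 mul1n mulnb.
rewrite (bigID p) /=.
under eq_bigr => a pa.
  under eq_num_words => w _ _ do rewrite pa /=.
  rewrite (IHm (fun w => P (a :: w))); over.
under [X in _ + X]eq_bigr => a pNa.
  under eq_num_words => w _ _ do rewrite (negbTE pNa) /=.
  rewrite (IHm P (fun w => Q (a :: w))); over.
rewrite [X in X + _]exchange_big [X in _ + X]exchange_big /=.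
have L j : \sum_(a <- s | p a) 'C(m, j) *
    (num_words (seq.filter p s) j (fun w => P (a :: w)) *
     num_words (seq.filter (predC p) s) (m - j) Q) =
    'C(m, j) * (num_words (seq.filter p s) j.+1 P *
     num_words (seq.filter (predC p) s) (m - j) Q).
  by rewrite -big_distrr -big_distrl /= -big_filter.
have S j : \sum_(a <- s | ~~ p a) 'C(m, j) *
    (num_words (seq.filter p s) j P *
     num_words (seq.filter (predC p) s) (m - j) (fun w => Q (a :: w))) =
    'C(m, j) * (num_words (seq.filter p s) j P *
     num_words (seq.filter (predC p) s) (m - j).+1 Q).
  by rewrite -!big_distrr /= -big_filter.
under eq_bigr do rewrite L.
under [X in _ + X]eq_bigr do rewrite S.
(* Pascal's rule splits the right side into the two sums on the left, according to which subword
   receives the first letter; the boundary term with C(m, m+1) vanishes. *)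
rewrite [RHS]big_ord_recl [X in _ = _ + X]/=.
under [X in _ = _ + X]eq_bigr => j _ do rewrite /bump add1n binS subSS mulnDl.
rewrite big_split /= [X in _ = _ + (X + _)]big_ord_recr /=.
rewrite [in X in _ = _ + (_ + X + _)]bin_small // mul0n addn0.
rewrite addnA addnC; congr (_ + _); rewrite big_ord_recl /= !bin0 !subn0.
by congr (_ + _); apply: eq_bigr => j _;
  rewrite /bump add1n -[in RHS](subnSK (ltn_ord j)).
Qed.

Lemma card_tuple_num_words n m (P : pred (seq nat)) :
  #|[set a : m.-tuple 'I_n | P [seq (val i).+1 | i <- a]]| =
  num_words (iota 1 n) m P.
Proof.
have -> : iota 1 n = [seq (val i).+1 | i <- enum 'I_n].
  by rewrite (map_comp succn) val_enum_ord -(iotaDl 1).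
elim: m P => [|m IHm] P /=.
  rewrite cardsE; case: (P [::]) / idP => P0 /=.
    rewrite (eq_card (B := predT)) ?card_tuple // => t.
    by rewrite tuple0 !inE.
  by rewrite eq_card0 // => t; rewrite tuple0 inE; apply/negP.
rewrite big_map big_enum /= -sum1_card.
rewrite (partition_big (fun t => thead t) predT) //=.
apply: eq_bigr => i _; rewrite -IHm sum1_card.
rewrite -(card_imset _ (f := fun t : m.-tuple 'I_n => [tuple of i :: t]));
  last first.
  by move=> t u /(congr1 val) /= [] /val_inj.
apply: eq_card => t; apply/andP/imsetP => /= [[]|[u]].
  case/tupleP: t => j t; rewrite inE theadE => Pt /eqP <-.
  by exists t; rewrite ?inE.
by rewrite inE => Pu ->; rewrite inE theadE eqxx.
Qed.

(** * Parking functions as a counting condition on levels *)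

Definition parkable (n : nat) (w : seq nat) : bool :=
  all (fun t => count (ltn t) w + t <= n) (iota 0 n.+1).

Lemma parkableP n w :
  reflect (forall t, t <= n -> count (ltn t) w + t <= n) (parkable n w).
Proof.
apply: (iffP allP) => [ok_w t le_tn | ok_w t]; last first.
  by rewrite mem_iota ltnS => /ok_w.
by apply: ok_w; rewrite mem_iota ltnS.
Qed.

Lemma count_ltnS t (w : seq nat) :
  count (ltn t) w = count (ltn t.+1) w + count_mem t.+1 w.
Proof. by elim: w => //= x w ->; rewrite (leq_eqVlt t.+1) eq_sym;
  case: eqP => [<-|]; lia. Qed.

Lemma leq_count_ltn t u (w : seq nat) :
  t <= u -> count (ltn u) w <= count (ltn t) w.
Proof. by move=> le_tu; apply: sub_count => x /=; lia. Qed.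

(** Raising the level by one past a letter that occurs lowers the count by at least one. *)
Lemma count_ltn_interval a b (w : seq nat) : a <= b ->
  (forall x, a < x <= b -> x \in w) ->
  count (ltn b) w + (b - a) <= count (ltn a) w.
Proof.
elim: b => [|b IHb] le_ab w_ab; first by have -> : a = 0; [lia | rewrite addn0].
have [-> | lt_ab] := eqVneq a b.+1; first lia.
have: count_mem b.+1 w > 0 by rewrite -has_count has_pred1; apply: w_ab; lia.
have: count (ltn b) w + (b - a) <= count (ltn a) w.
  by apply: IHb => [|x lt_x]; [lia | apply: w_ab; lia].
by rewrite (count_ltnS b); lia.
Qed.

(** Pigeonhole: distinct occupied spaces beyond t lie among t+1, ..., n. *)
Lemma uniq_parkable n (occ : seq nat) :
  uniq occ -> {in occ, forall s, s <= n} -> parkable n occ.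
Proof.
move=> uniq_occ le_occ; apply/parkableP => t le_tn.
have sub_occ : {subset seq.filter (ltn t) occ <= iota t.+1 (n - t)}.
  by move=> s; rewrite mem_filter mem_iota /= => /andP[lt_ts /le_occ]; lia.
have := uniq_leq_size (filter_uniq _ uniq_occ) sub_occ.
by rewrite size_iota size_filter leq_subRL // addnC.
Qed.

Variant first_free_spec n (occ : seq nat) p : option nat -> Prop :=
  | FirstFreeSome s of p <= s <= n & s \notin occ
      & (forall x, p <= x < s -> x \in occ) : first_free_spec n occ p (Some s)
  | FirstFreeNone of (forall x, p <= x <= n -> x \in occ) :
      first_free_spec n occ p None.

Lemma first_freeP n occ p : first_free_spec n occ p (first_free n occ p).
Proof.
rewrite /first_free; move m_def: (n.+1 - p) => m.
elim: m p m_def => [|m IHm] p m_def /=; first by constructor => x; lia.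
have [p_occ | pN_occ] /= := boolP (p \in occ); last first.
  by constructor => // [|x]; lia.
have [|s le_s sN_occ occ_s | occ_n] := IHm p.+1; first by lia.
  constructor=> // [|x]; first lia.
  by have [-> // | ne_xp lt_x] := eqVneq x p; apply: occ_s; lia.
constructor=> x; have [-> // | ne_xp lt_x] := eqVneq x p.
by apply: occ_n; lia.
Qed.

(* Parking a car that prefers p in the space s changes the counts only at the
   levels t in [p, s), where all of p, ..., t are occupied. *)
Lemma all_cars_parkE n occ prefs :
  uniq occ -> {in occ, forall s, s <= n} -> all (ltn 0) prefs ->
  all_cars_park n occ prefs = parkable n (occ ++ prefs).
Proof.
elim: prefs occ => [|p prefs IHp] occ uniq_occ le_occ /=.
  by rewrite cats0 uniq_parkable.
case/andP=> p_gt0 prefs_gt0.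
case: first_freeP => [s le_s sN_occ occ_s | occ_n]; last first.
  apply/esym/negP => /parkableP ok_n.
  have [lt_np | le_pn] := ltnP n p.
    by have := ok_n n (leqnn n); rewrite count_cat /= lt_np; lia.
  (* The spaces p, ..., n are full, so together with the arriving car more than n-p+1 cars count at
     level p-1. *)
  have := ok_n p.-1; rewrite count_cat /= (_ : p.-1 < p); last lia.
  have : count (ltn n) occ + (n - p.-1) <= count (ltn p.-1) occ.
    by apply: count_ltn_interval => [|x lt_x]; [lia | apply: occ_n; lia].
  lia.
rewrite IHp //=; last first.
- by move=> x; rewrite inE => /predU1P[-> | /le_occ //]; lia.
- by rewrite sN_occ.
apply/parkableP/parkableP => ok_n t le_tn; move: (ok_n t le_tn) => /=.
  by rewrite !count_cat /=; lia.
rewrite !count_cat /=; case: (ltnP t s) => lt_ts; case: (ltnP t p) => lt_tp //;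
  try lia.
(* Here p <= t < s. The arriving car already counts at level p-1, and the full spaces p, ..., t
   carry that bound over to level t. *)
have := ok_n p.-1; rewrite count_cat /= (_ : p.-1 < p); last lia.
have : count (ltn t) occ + (t - p.-1) <= count (ltn p.-1) occ.
  by apply: count_ltn_interval => [|x lt_x]; [lia | apply: occ_s; lia].
by have := @leq_count_ltn p.-1 t prefs; lia.
Qed.

Lemma parking_functionE n prefs :
  all (ltn 0) prefs -> parking_function n prefs = parkable n prefs.
Proof. by move=> prefs_gt0; rewrite /parking_function all_cars_parkE. Qed.

(** * Splitting recursions and the closed form for m cars on n spaces *)

Definition num_parkable (n m : nat) : nat :=
  num_words (iota 1 n) m (parkable n).

Definition num_parkable_cons (n s l : nat) : nat :=
  num_words (iota 1 s) n.-1 (fun w => parkable n (l :: w)).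

Lemma mem_iota1_leq n w : all (mem (iota 1 n)) w -> all (geq n) w.
Proof. by apply: sub_all => x; rewrite /= mem_iota => /andP[]. Qed.

Lemma mem_iota1_gt0 n w : all (mem (iota 1 n)) w -> all (ltn 0) w.
Proof. by apply: sub_all => x; rewrite /= mem_iota => /andP[]. Qed.

Lemma filter_geq_iota1 s n : s <= n -> seq.filter (geq s) (iota 1 n) = iota 1 s.
Proof.
move=> le_sn; rewrite -(subnKC le_sn) iotaD filter_cat.
rewrite (all_filterP _); last by apply/allP => x; rewrite mem_iota /=; lia.
rewrite -[RHS]cats0; congr (_ ++ _); apply/eqP;
  rewrite -[_ == _]negbK -has_filter.
by apply/hasPn => x; rewrite mem_iota /=; lia.
Qed.

Lemma filter_gtn_iota1 s n : s <= n ->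
  seq.filter (predC (geq s)) (iota 1 n) = map (addn s) (iota 1 (n - s)).
Proof.
move=> le_sn; rewrite -{1}(subnKC le_sn) iotaD filter_cat -iotaDl addnC.
rewrite (_ : seq.filter _ (iota 1 s) = [::]) ?cat0s.
  by apply/all_filterP/allP => x; rewrite mem_iota /=; lia.
apply/eqP; rewrite -[_ == _]negbK -has_filter.
by apply/hasPn => x; rewrite mem_iota /=; lia.
Qed.

Lemma count_filter_geq l t (w : seq nat) : t <= l ->
  count (ltn t) w = count (ltn t) (seq.filter (geq l) w) + count (ltn l) w.
Proof.
move=> le_tl; elim: w => //= x w ->.
by case: (leqP x l) => /=; case: (ltnP t x) => /=; lia.
Qed.

Lemma size_filter_geq l (w : seq nat) :
  size (seq.filter (geq l) w) + count (ltn l) w = size w.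
Proof. by elim: w => //= x w <-; case: (leqP x l) => /=; lia. Qed.

(** Letters beyond l, lowered by l, form a word on the spaces after l, whose level t is level l+t of
    [w]. *)
Lemma count_map_subn l t (w : seq nat) :
  count (ltn t) (map (subn^~ l) (seq.filter (predC (geq l)) w)) =
  count (ltn (l + t)) w.
Proof.
elim: w => //= x w <-; case: (leqP x l) => /= lt_lx; last rewrite ltn_subRL //.
by rewrite ltnNge (leq_trans lt_lx) ?leq_addr.
Qed.

Lemma parkable_geq n w : parkable n w -> all (geq n) w.
Proof.
move/parkableP/(_ n (leqnn n)) => ok_n; rewrite all_count.
by have := size_filter_geq n w; rewrite size_filter; move: ok_n; lia.
Qed.

Lemma num_words_shift n s m P : s <= n ->
  num_words (seq.filter (predC (geq s)) (iota 1 n)) m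
    (fun w => P (map (subn^~ s) w)) = num_words (iota 1 (n - s)) m P.
Proof.
move=> le_sn; rewrite filter_gtn_iota1 // num_words_map.
apply: eq_num_words => w _ _; congr P.
by rewrite -map_comp map_id_in // => x _ /=; rewrite addKn.
Qed.

(** Cars preferring space 1 count only at level 0, where the condition follows from m <= n+1. Their
    positions are therefore free, and the other cars, lowered by 1, must be parkable on n spaces. *)
Lemma num_parkableS n m : m <= n.+1 ->
  num_parkable n.+1 m = \sum_(j < m.+1) 'C(m, j) * num_parkable n (m - j).
Proof.
move=> le_mn.
pose Q w := parkable n (map (subn^~ 1) w).
have {1}-> : num_parkable n.+1 m = num_words (iota 1 n.+1) m
    (fun w => xpredT (seq.filter (geq 1) w) &&
      Q (seq.filter (predC (geq 1)) w)).
  apply: eq_num_words => w sz_w _ /=.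
  apply/parkableP/parkableP => ok_w t le_tn.
    by have := ok_w t.+1; rewrite count_map_subn add1n; lia.
  case: t le_tn => [|t] le_tn; first by have := count_size (ltn 0) w; lia.
  by have := ok_w t; rewrite count_map_subn add1n; lia.
rewrite (num_words_shuffle _ _ _ xpredT Q); apply: eq_bigr => j _.
by rewrite filter_geq_iota1 // num_words_nseq mul1n num_words_shift ?subSS
  ?subn0.
Qed.

(** This is x d/dx of the binomial theorem for (x+1)^m; the extra factor x+1 avoids the exponent
    m-1. *)
Lemma sum_bin_weighted x m :
  x.+1 * (\sum_(j < m.+1) 'C(m, j) * ((m - j) * x ^ (m - j))) =
    m * x * x.+1 ^ m.
Proof.
case: m => [|m]; first by rewrite big_ord1 !muln0.
rewrite big_ord_recr /= subnn mul0n muln0 addn0.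
have E (j : 'I_m.+1) : 'C(m.+1, j) * ((m.+1 - j) * x ^ (m.+1 - j)) =
    m.+1 * x * ('C(m, j) * x ^ (m - j)).
  rewrite mulnA [_ * (m.+1 - j)]mulnC -mul_bin_down /= subSn ?expnS; first lia.
  by have := ltn_ord j; lia.
under eq_bigr do rewrite E.
rewrite -big_distrr /=.
have -> : \sum_(i < m.+1) 'C(m, i) * x ^ (m - i) = x.+1 ^ m.
  by rewrite -[x.+1]addn1 expnDn; apply: eq_bigr => i _; rewrite exp1n muln1.
rewrite expnS; lia.
Qed.

(** Induction on n: inserting the closed form into [num_parkableS] leaves a binomial sum and a
    weighted binomial sum. The factor n+1 clears the exponent m-1. *)
Lemma num_parkableE n m : m <= n.+1 ->
  n.+1 * num_parkable n m = (n.+1 - m) * n.+1 ^ m.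
Proof.
elim: n m => [|n IHn] m le_mn.
  by case: m le_mn => [|[|]] //=; rewrite /num_parkable /= ?big_nil.
(* For m = n+2 the term j = 0 falls outside the induction hypothesis; level 0 shows directly that so
   many cars do not fit. *)
have [-> | ne_mn] := eqVneq m n.+2.
  rewrite subnn mul0n /num_parkable num_words0 ?muln0 // => w sz_w.
  move=> /mem_iota1_gt0; rewrite all_count sz_w => /eqP sz.
  by apply/negP => /parkableP/(_ 0); rewrite sz; lia.
have {ne_mn}le_mn : m <= n.+1 by lia.
rewrite num_parkableS //; set G := \sum_(j < _) _.
have GE : n.+1 * G + \sum_(j < m.+1) 'C(m, j) * ((m - j) * n.+1 ^ (m - j)) =
    n.+1 * n.+2 ^ m.
  rewrite /G -[n.+2]addn1 expnDn !big_distrr -big_split /=.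
  apply: eq_bigr => j _; rewrite exp1n muln1 mulnCA IHn; last lia.
  by rewrite -mulnDr -mulnDl mulnCA; congr (_ * (_ * _)); lia.
have := sum_bin_weighted n.+1 m; move: GE; set S := \sum_(j < _) _.
move: S (n.+2 ^ m) => S A GE SE.
apply/eqP; rewrite -(eqn_pmul2l (ltn0Sn n)) -(eqn_add2r (n.+2 * S)); apply/eqP.
rewrite mulnCA -mulnDr GE SE mulnBl.
have : m * A <= n.+2 * A by rewrite leq_mul2r; lia.
nia.
Qed.

(** Only words starting with l contribute, and the bound s on the preferences becomes a restriction
    of the alphabet. *)
Lemma num_parkingE n s l : 0 < l <= s -> s <= n ->
  num_parking n s l = num_parkable_cons n s l.
Proof.
case: n => [|n]; first by lia.
move=> /andP[l_gt0 le_ls] le_sn.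
rewrite /num_parking (card_tuple_num_words n.+1 n.+1 (fun w =>
  [&& parking_function n.+1 w, ohead w == Some l & all (geq s) w])).
rewrite num_wordsS (bigD1_seq l) ?iota_uniq ?mem_iota //=; last lia.
rewrite [X in _ + X]big1 ?addn0 => [|a ne_al]; last first.
  by rewrite num_words0 // => w _ _ /=;
    rewrite [_ == Some l](negbTE ne_al) andbF.
rewrite -[1 :: _]/(iota 1 n.+1) -(@num_words_filter (geq s)); last first.
  by move=> w /and3P[_ _ /andP[]].
rewrite filter_geq_iota1 //; apply: eq_num_words => w _ ws /=.
rewrite eqxx le_ls parking_functionE /=;
  last by rewrite l_gt0 (mem_iota1_gt0 ws).
by rewrite (mem_iota1_leq ws) andbT.
Qed.

(* Split off the cars that prefer the space s + 1; at most k of them fit. *)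
Lemma num_parkable_consS s k l : 0 < l <= s -> 0 < k ->
  num_parkable_cons (s + k) s.+1 l =
  \sum_(j < k.+1) 'C((s + k).-1, j) * num_parkable_cons (s + k - j) s l.
Proof.
move=> /andP[l_gt0 le_ls] k_gt0.
pose P (w : seq nat) := size w <= k.
(* If j cars prefer s+1, the rest must park on s+k-j spaces; [Q] recovers this number from the
   length of the subword, since it cannot refer to j. *)
pose Q w := parkable (size w).+1 (l :: w).
have -> : num_parkable_cons (s + k) s.+1 l = num_words (iota 1 s.+1) (s + k).-1
    (fun w => P (seq.filter (predC (geq s)) w) &&
      Q (seq.filter (predC (predC (geq s))) w)).
  apply: eq_num_words => w sz_w ws.
  have sE : seq.filter (predC (predC (geq s))) w = seq.filter (geq s) w.
    by apply: eq_filter => x /=; rewrite negbK.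
  have sizeE := size_filter_geq s w; rewrite sz_w in sizeE.
  have PE : size (seq.filter (predC (geq s)) w) = count (ltn s) w.
    by rewrite size_filter; apply: eq_count => x /=; rewrite ltnNge.
  rewrite sE /P /Q PE.
  have w_le t : s < t -> count (ltn t) w = 0.
    move=> lt_st; apply/eqP; rewrite -leqn0 leqNgt -has_count -all_predC.
    by apply: sub_all (mem_iota1_leq ws) => x /=; lia.
  have f_le t : s <= t -> count (ltn t) (seq.filter (geq s) w) = 0.
    move=> le_st; apply/eqP; rewrite -leqn0 leqNgt -has_count -all_predC.
    by rewrite all_filter; apply/allP => x _; apply/implyP => /=; lia.
  apply/parkableP/andP => [ok_w | [le_k /parkableP ok_w] t le_t].
    have le_k : count (ltn s) w <= k by have := ok_w s; rewrite /=; lia.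
    split=> //; apply/parkableP => t le_t.
    have [lt_st | le_ts] := ltnP s t.
      by rewrite /= f_le; lia.
    by have := ok_w t; rewrite /= (@count_filter_geq s) //; lia.
  have [lt_st | le_ts] := ltnP s t; first by rewrite /= w_le; lia.
  by have := ok_w t; rewrite /= (@count_filter_geq s t w) //; lia.
have sP : seq.filter (predC (geq s)) (iota 1 s.+1) = [:: s.+1].
  by rewrite filter_gtn_iota1 // subSnn /= addn1.
have sQ : seq.filter (predC (predC (geq s))) (iota 1 s.+1) = iota 1 s.
  rewrite -(@filter_geq_iota1 s s.+1) //.
  by apply: eq_filter => x /=; rewrite negbK.
rewrite num_words_shuffle sP sQ prednK; last lia.
(* The shuffle sums over all j < s+k; the terms with j > k vanish by [P]. *)
rewrite (big_ord_widen (s + k) (fun j => 'C((s + k).-1, j) *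
  num_parkable_cons (s + k - j) s l)); last lia.
rewrite [RHS]big_mkcond /=; apply: eq_bigr => j _.
rewrite num_words_nseq /P size_nseq ltnS; case: leqP => le_jk;
  last by rewrite muln0.
rewrite mul1n; congr (_ * _); rewrite /num_parkable_cons.
rewrite (_ : (s + k - j).-1 = (s + k).-1 - j); last lia.
by apply: eq_num_words => w sz_w _; rewrite /Q sz_w; congr parkable; lia.
Qed.

(* Raising the first preference from l to l + 1 breaks the parking function
   exactly when l cars (among them the first) prefer the spaces up to l. *)
Lemma num_parkable_cons_diff n l : l.+1 < n ->
  num_parkable_cons n n l.+1 = num_parkable_cons n n l.+2 +
    'C(n.-1, l) * (num_parkable l l * num_parkable (n - l.+1) (n - l.+1)).
Proof.
move=> lt_ln.
pose P w := (size w == l) && parkable l w.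
pose Q w := parkable (n - l.+1) (map (subn^~ l.+1) w).
have split w : size w = n.-1 -> all (mem (iota 1 n)) w ->
  parkable n (l.+1 :: w) = parkable n (l.+2 :: w) +
    (P (seq.filter (geq l.+1) w) && Q (seq.filter (predC (geq l.+1)) w)) :> nat.
  move=> sz_w _; have sizeE := size_filter_geq l.+1 w; rewrite sz_w in sizeE.
  case: (boolP (parkable n (l.+2 :: w))) => [/parkableP ok_w | not_ok].
    rewrite (_ : parkable n _ = true); last first.
      by apply/parkableP => t /ok_w /=; lia.
    rewrite (_ : P _ = false) //; apply/negP => /andP[/eqP sz_u _].
    by have := ok_w l.+1; rewrite /= ltnSn; lia.
  rewrite add0n; congr nat_of_bool.
  apply/parkableP/andP => [ok_w|].
    (* Only level l+1 distinguishes the two first preferences, so the bound there must be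
       attained. *)
    have cE : count (ltn l.+1) w + l.+1 = n.
      apply/eqP; rewrite eqn_leq; apply/andP; split.
        by have := ok_w l.+1; rewrite /= ltnn; lia.
      rewrite leqNgt; apply: contra not_ok => lt_n; apply/parkableP => t le_tn.
      have [-> | ne_tl] := eqVneq t l.+1; first by rewrite /= ltnSn; lia.
      by have := ok_w t le_tn; rewrite /=; lia.
    split; first (apply/andP; split; first by apply/eqP; lia).
      apply/parkableP => t le_tl.
      have := ok_w t; rewrite /= (@count_filter_geq l.+1); last lia.
      by rewrite ltnS le_tl; lia.
    apply/parkableP => t le_tn; rewrite count_map_subn.
    by have := ok_w (l.+1 + t); rewrite /=; lia.
  case=> /andP[/eqP sz_u /parkableP ok_u] /parkableP ok_v t le_tn.
  have [lt_lt | le_tl] := ltnP l t.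
    have := ok_v (t - l.+1); rewrite count_map_subn subnKC // /=; lia.
  have := ok_u t le_tl; rewrite /= (@count_filter_geq l.+1 t w); last lia.
  lia.
rewrite /num_parkable_cons (num_wordsD split); congr (_ + _).
rewrite num_words_shuffle filter_geq_iota1; last lia.
have lt_l : l < n.-1.+1 by lia.
rewrite (bigD1 (Ordinal lt_l)) //= [X in _ + X]big1 => [|j ne_jl]; last first.
  rewrite num_words0 ?muln0 // => w sz_w _; rewrite /P sz_w.
  by rewrite (_ : (_ == l) = false) //; apply/negP => /eqP jl; case/eqP: ne_jl;
    apply: val_inj.
rewrite addn0 num_words_shift; last lia.
congr (_ * (_ * _)); last by rewrite /num_parkable; congr num_words; lia.
(* Being parkable on l spaces rules out the letter l+1, so the alphabet shrinks to 1, ..., l. *)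
rewrite -[1 :: _]/(iota 1 l.+1) -(@num_words_filter (geq l)); last first.
  by move=> w /andP[_ /parkable_geq].
rewrite filter_geq_iota1 //.
by apply: eq_num_words => w sz_w _; rewrite /P sz_w eqxx.
Qed.

(** A first car preferring space 1 counts only at level 0, where the n other cars leave room for
    it. *)
Lemma num_parkable_cons1 n : num_parkable_cons n.+1 n.+1 1 =
  num_parkable n.+1 n.
Proof.
apply: eq_num_words => w sz_w _.
apply/parkableP/parkableP => ok_w t le_tn; have := ok_w t le_tn; rewrite /=.
  lia.
by case: t le_tn => [|t] le_tn /=; [have := count_size (ltn 0) w; lia | lia].
Qed.

Local Open Scope ring_scope.

(** * Limits of the normalised counts *)

Section Asymptotics.
Local Open Scope classical_set_scope.
Variable R : realType.
Implicit Types l k n : nat.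

Let ratio (a n : nat) : R := (n.+1 - a)%:R / n.+1%:R.

Lemma ratioE a n : (a <= n)%N -> ratio a n = 1 - a%:R * harmonic n.
Proof.
move=> le_an; rewrite /ratio /harmonic /= natrB; last by lia.
by rewrite mulrBl divff // pnatr_eq0.
Qed.

Lemma cvg_ratio a : ratio a @ \oo --> (1 : R).
Proof.
have : (1 : R) - a%:R * harmonic n @[n --> \oo] --> (1 : R) - a%:R * 0.
  by apply: cvgB; [exact: cvg_cst | apply: cvgMl_tmp; exact: cvg_harmonic].
rewrite mulr0 subr0; apply: cvg_trans; apply: near_eq_cvg.
by exists a => // n /= le_an; rewrite ratioE.
Qed.

(** Passing from i to i+1 multiplies by (n-1-i)/((i+1)(n+1)), and n-1-i = (n+1)-(i+2) makes this
    [ratio i.+2 n] over i+1. *)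
Lemma cvg_bin_ratio i :
  'C(n.-1, i)%:R / n.+1%:R ^+ i @[n --> \oo] --> (i`!%:R^-1 : R).
Proof.
elim: i => [|i IHi].
  under eq_fun do rewrite bin0 expr0 divr1.
  by rewrite fact0 invr1; exact: cvg_cst.
have E n : 'C(n.-1, i.+1)%:R / n.+1%:R ^+ i.+1 =
    'C(n.-1, i)%:R / n.+1%:R ^+ i * ratio i.+2 n * i.+1%:R^-1 :> R.
  have i0 : i.+1%:R != 0 :> R by rewrite pnatr_eq0.
  have n0 : n.+1%:R != 0 :> R by rewrite pnatr_eq0.
  apply: (mulfI i0); rewrite mulrA -natrM mul_bin_left /ratio.
  rewrite (_ : n.-1 - i = n.+1 - i.+2)%N; last by lia.
  rewrite natrM exprSr; move: (n.+1%:R) (i.+1%:R) n0 i0 => x y x0 y0.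
  by field; rewrite x0 y0 expf_neq0.
under eq_fun do rewrite E.
have -> : (i.+1`!%:R^-1 : R) = i`!%:R^-1 * 1 * i.+1%:R^-1.
  by rewrite mulr1 -invfM -natrM mulnC factS.
by apply: cvgMr_tmp; apply: cvgM => //; exact: cvg_ratio.
Qed.

(** Both bounds come from 1+x <= e^x: the upper one with x = -a/(n+1), the lower one with x =
    a/(n+1-a), applied to the inverse of the ratio in n+1-a of the n+1 factors. *)
Lemma ratio_expr_bounds a n : (a <= n)%N ->
  expR (- a%:R) * ratio a n ^+ a <= ratio a n ^+ n.+1 <= expR (- a%:R).
Proof.
move=> le_an.
have n0 : n.+1%:R != 0 :> R by rewrite pnatr_eq0.
have na0 : (n.+1 - a)%:R != 0 :> R by rewrite pnatr_eq0; lia.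
have ratio_gt0 : 0 < ratio a n by rewrite divr_gt0 // ltr0n; lia.
apply/andP; split; last first.
  rewrite (_ : - a%:R = (- a%:R / n.+1%:R) * n.+1%:R); last by rewrite divfK.
  rewrite expRM_natr lerXn2r ?nnegrE ?expR_ge0 ?(ltW ratio_gt0) //.
  apply: le_trans (expR_ge1Dx _).
  by rewrite ratioE // /harmonic /= mulNr.
rewrite -[n.+1 in leRHS](@subnK a) ?exprD; last by lia.
rewrite ler_pM2r ?exprn_gt0 // -[leRHS]invrK expRN lef_pV2 ?posrE ?expR_gt0 //;
  last by rewrite invr_gt0 exprn_gt0.
rewrite -exprVn (_ : a%:R = a%:R / (n.+1 - a)%:R * (n.+1 - a)%:R);
  last by rewrite divfK.
rewrite expRM_natr lerXn2r ?nnegrE ?expR_ge0 ?invr_ge0 ?(ltW ratio_gt0) //.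
apply: le_trans (expR_ge1Dx _).
by rewrite /ratio invf_div -[X in X + _](divff na0) -mulrDl -natrD subnK //
  ltnW.
Qed.

(** A squeeze settles the exponent n+1; dividing by c+1 factors that tend to 1 gives n-c. *)
Lemma cvg_ratio_expr a c : ratio a n ^+ (n - c) @[n --> \oo] --> expR (- a%:R).
Proof.
have cvg1 m : ratio a n ^+ m @[n --> \oo] --> (1 : R).
  rewrite -[1](expr1n _ m).
  by apply: (cvg_comp _ (fun x : R => x ^+ m) (@cvg_ratio a));
    apply: exprn_continuous.
have cvgN : ratio a n ^+ n.+1 @[n --> \oo] --> expR (- a%:R).
  apply: (@squeeze_cvgr _ _ _ _ (fun n => expR (- a%:R) * ratio a n ^+ a)
    (fun=> expR (- a%:R))).
  - by exists a => // n /= /ratio_expr_bounds.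
  - rewrite -[X in _ --> X]mulr1; apply: cvgMl_tmp; exact: cvg1.
  - exact: cvg_cst.
have : ratio a n ^+ n.+1 / ratio a n ^+ c.+1 @[n --> \oo] --> expR (- a%:R) / 1.
  apply: cvgM => //; apply: cvgV; first exact: oner_neq0.
  exact: cvg1.
rewrite divr1; apply: cvg_trans; apply: near_eq_cvg.
exists (a + c.+1)%N => // n /= le_n.
have ratio_neq0 : ratio a n != 0.
  by rewrite /ratio mulf_neq0 ?invr_eq0 ?pnatr_eq0 //; lia.
by rewrite -expfB; [congr (_ ^+ _); lia | lia].
Qed.

(** Common coefficient of two recursions after normalisation: a = i when splitting off the largest
    preference, a = i+1 when raising the first preference from i+1 to i+2. *)
Definition shift_weight (i a n : nat) : R :=
  'C(n.-1, i)%:R * (n.+1 - a)%:R ^+ (n - i.+2) / n.+1%:R ^+ (n - 2).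

Lemma cvg_shift_weight i a :
  shift_weight i a @ \oo --> expR (- a%:R) / i`!%:R.
Proof.
rewrite mulrC.
have : 'C(n.-1, i)%:R / n.+1%:R ^+ i * ratio a n ^+ (n - i.+2) @[n --> \oo]
    --> i`!%:R^-1 * expR (- a%:R).
  by apply: cvgM; [exact: cvg_bin_ratio | exact: cvg_ratio_expr].
apply: cvg_trans; apply: near_eq_cvg; exists i.+2 => // n /= le_in.
rewrite /shift_weight /ratio (_ : n - 2 = i + (n - i.+2))%N; last by lia.
rewrite exprD expr_div_n invfM.
by rewrite -!mulrA; congr (_ * _); rewrite mulrCA !mulrA.
Qed.

Lemma rho_seqE l k n : (2 <= n)%N ->
  rho_seq R l k n = (num_parking n (n - k) l)%:R / n.+1%:R ^+ (n - 2).
Proof.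
by move=> le2n; rewrite /rho_seq (_ : n%:Z - 2 = (n - 2)%N%:Z) //; lia.
Qed.

(** The integer exponent also covers n = 0, where the count is 1; these are the coefficients of P up
    to n!. *)
Lemma num_parkable_diag n : (num_parkable n n)%:R = n.+1%:R ^ (n%:Z - 1) :> R.
Proof.
have n0 : n.+1%:R != 0 :> R by rewrite pnatr_eq0.
apply: (mulfI n0); rewrite -natrM num_parkableE // subSnn mul1n natrX.
by rewrite -[X in X * _]expr1z -expfzDr // (_ : 1 + (n%:Z - 1) = n%:Z) //; lia.
Qed.

Lemma num_parkable_diag_gt0 n : (0 < n)%N ->
  (num_parkable n n)%:R = n.+1%:R ^+ n.-1 :> R.
Proof.
move=> n_gt0; rewrite num_parkable_diag.
by rewrite (_ : n%:Z - 1 = n.-1%:Z) //; lia.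
Qed.

(** The sequence is eventually constant: n-1 cars on n spaces give 2(n+1)^(n-2). *)
Lemma cvg_rho_seq10 : rho_seq R 1 0 @ \oo --> (2 : R).
Proof.
apply: cvg_near_cst; exists 2%N => // n /= le2n.
rewrite rho_seqE // subn0 num_parkingE; [|lia..].
case: n le2n => // n le2n; rewrite num_parkable_cons1.
have n0 : n.+2%:R != 0 :> R by rewrite pnatr_eq0.
rewrite (_ : (num_parkable n.+1 n)%:R =
  2 * n.+2%:R ^+ (n.+1 - 2)) ?mulfK ?expf_neq0 //.
apply: (mulfI n0); rewrite -natrM num_parkableE; last by lia.
rewrite (_ : n.+2 - n = 2)%N; last by lia.
rewrite natrM natrX (_ : n.+1 - 2 = n.-1)%N; last by lia.
by case: n le2n {n0} => // n _; rewrite exprS /= mulrCA.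
Qed.

Lemma rho_seq0_diff l n : (l.+2 <= n)%N ->
  rho_seq R l.+2 0 n = rho_seq R l.+1 0 n
    - (num_parkable l l)%:R * shift_weight l l.+1 n.
Proof.
move=> lt_ln; rewrite !rho_seqE ?subn0; [|lia..].
rewrite !num_parkingE; [|lia..].
rewrite (@num_parkable_cons_diff n l) // natrD !natrM /shift_weight.
rewrite (num_parkable_diag_gt0 (n := n - l.+1)); last by lia.
rewrite (_ : (n - l.+1).+1 = n.+1 - l.+1)%N; last by lia.
rewrite (_ : (n - l.+1).-1 = n - l.+2)%N; last by lia.
by rewrite mulrDl -[LHS]addr0 -addrA; congr (_ + _); ring.
Qed.

(** The split at the largest preference n-k+1 is solved for its i = 0 term. In the others n-k =
    (n-i)-(k-i), and [shift_weight i i n] converts the normalisation at n-i to that at n. *)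
Lemma rho_seq_rec l k n : (0 < l)%N -> (0 < k)%N -> (l + k + 2 <= n)%N ->
  rho_seq R l k n = rho_seq R l (k - 1) n -
    \sum_(1 <= i < k.+1) shift_weight i i n * rho_seq R l (k - i) (n - i).
Proof.
move=> l_gt0 k_gt0 le_n.
have [lek le2 lek1] : [/\ (k <= n)%N, (2 <= n)%N & (k - 1 <= n)%N] by split;
  lia.
apply/eqP; rewrite eq_sym subr_eq; apply/eqP.
rewrite !rho_seqE // !num_parkingE; [|lia..].
rewrite (_ : n - (k - 1) = (n - k).+1)%N; last by lia.
have := @num_parkable_consS (n - k) k l; rewrite subnK // => ->; [|lia..].
rewrite -(big_mkord xpredT (fun j => 'C(n.-1, j) *
  num_parkable_cons (n - j) (n - k) l)%N) big_ltn // bin0 mul1n subn0.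
rewrite natrD mulrDl; congr (_ + _).
rewrite natr_sum mulr_suml; apply: eq_big_nat => i /andP[i_gt0 le_ik].
rewrite rho_seqE ?num_parkingE; [|lia..].
rewrite (_ : n - i - (k - i) = n - k)%N; last by lia.
rewrite /shift_weight (_ : (n - i).+1 = n.+1 - i)%N; last by lia.
rewrite (_ : n - i - 2 = n - i.+2)%N; last by lia.
have ni0 : (n.+1 - i)%:R ^+ (n - i.+2) != 0 :> R.
  by rewrite expf_neq0 // pnatr_eq0; lia.
have n0 : n.+1%:R ^+ (n - 2) != 0 :> R by rewrite expf_neq0 // pnatr_eq0.
by rewrite natrM; field; rewrite ni0 n0.
Qed.

Lemma cvg_rho_seq0 l : cvgn (rho_seq R l.+1 0).
Proof.
elim: l => [|l /cvg_ex[/= r IHl]]; first by apply/cvg_ex; exists 2;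
  exact: cvg_rho_seq10.
apply/cvg_ex; exists (r - (num_parkable l l)%:R * (expR (- l.+1%:R) / l`!%:R)).
have : rho_seq R l.+1 0 n - (num_parkable l l)%:R * shift_weight l l.+1 n
    @[n --> \oo] --> r - (num_parkable l l)%:R * (expR (- l.+1%:R) / l`!%:R).
  by apply: cvgB => //; apply: cvgMl_tmp; exact: cvg_shift_weight.
apply: cvg_trans; apply: near_eq_cvg; exists l.+2 => // n /= le_n.
by rewrite rho_seq0_diff.
Qed.

Lemma cvg_rho_seq_rec l k : (0 < l)%N -> (0 < k)%N ->
  (forall j, (j < k)%N -> cvgn (rho_seq R l j)) ->
  rho_seq R l k @ \oo --> rho R l (k - 1)
    - \sum_(1 <= i < k.+1) expR (- i%:R) / i`!%:R * rho R l (k - i).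
Proof.
move=> l_gt0 k_gt0 cvg_lt.
(* The filter 0 < i repeats the lower end of the range so that [cvg_big] passes it to each summand,
   where it yields k-i < k. *)
have : rho_seq R l (k - 1) n - \sum_(i <- index_iota 1 k.+1 | (0 < i)%N)
      shift_weight i i n * rho_seq R l (k - i) (n - i) @[n --> \oo] -->
    rho R l (k - 1) - \sum_(i <- index_iota 1 k.+1 | (0 < i)%N)
      expR (- i%:R) / i`!%:R * rho R l (k - i).
  apply: cvgB; first by apply: cvg_lt; lia.
  apply: (cvg_big (op := +%R)); first exact: add_continuous.
  move=> i i_gt0; apply: cvgM; first exact: cvg_shift_weight.
  apply: (cvg_comp (subn^~ i) (rho_seq R l (k - i))); first exact: cvg_subnr.
  by apply: cvg_lt; lia.
have E (F : nat -> R) : \sum_(i <- index_iota 1 k.+1 | (0 < i)%N) F i =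
    \sum_(1 <= i < k.+1) F i.
  rewrite big_seq_cond [RHS]big_seq_cond; apply: eq_bigl => i.
  by rewrite mem_index_iota; case: (i).
rewrite E; apply: cvg_trans; apply: near_eq_cvg.
by exists (l + k + 2)%N => // n le_n; rewrite (@rho_seq_rec l k n) // -E.
Qed.

(** Strong induction on k. Convergence is what makes [rho], defined by [limn], a genuine limit. *)
Lemma is_cvg_rho_seq l k : (0 < l)%N -> cvgn (rho_seq R l k).
Proof.
move=> l_gt0; elim/ltn_ind: k => -[|k] IHk.
  by rewrite -(prednK l_gt0); exact: cvg_rho_seq0.
by apply/cvg_ex; eexists; apply: cvg_rho_seq_rec.
Qed.

Lemma rho_rec l k : (0 < l)%N -> (0 < k)%N ->
  rho R l k = rho R l (k - 1)
    - \sum_(1 <= i < k.+1) expR (- i%:R) / i`!%:R * rho R l (k - i).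
Proof.
move=> l_gt0 k_gt0; apply: cvg_lim; first exact: Rhausdorff.
by apply: cvg_rho_seq_rec => // j _; exact: is_cvg_rho_seq.
Qed.

Lemma rho10 : rho R 1 0 = 2.
Proof. by apply: cvg_lim; [exact: Rhausdorff | exact: cvg_rho_seq10]. Qed.

Lemma rho0_diff l : rho R l.+2 0 = rho R l.+1 0
  - (l.+1%:R ^ (l%:Z - 1) * (expR (- l.+1%:R) / l`!%:R)).
Proof.
apply: cvg_lim; first exact: Rhausdorff.
rewrite -num_parkable_diag.
have : rho_seq R l.+1 0 n - (num_parkable l l)%:R * shift_weight l l.+1 n
    @[n --> \oo] -->
    rho R l.+1 0 - (num_parkable l l)%:R * (expR (- l.+1%:R) / l`!%:R).
  apply: cvgB; first exact: is_cvg_rho_seq.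
  by apply: cvgMl_tmp; exact: cvg_shift_weight.
apply: cvg_trans; apply: near_eq_cvg; exists l.+2 => // n /= le_n.
by rewrite rho_seq0_diff.
Qed.

End Asymptotics.

(** * Coefficients of formal power series *)

Section FpsCoef.
Variable A : comNzRingType.
Implicit Types f g : fps A.

Lemma coef_fpsB f g n : fps_coef (f - g) n = fps_coef f n - fps_coef g n.
Proof. by []. Qed.

Lemma coef_fpsD f g n : fps_coef (f + g) n = fps_coef f n + fps_coef g n.
Proof. by []. Qed.

Lemma coef_fps_sum m (F : 'I_m -> fps A) n :
  fps_coef (\sum_(i < m) F i) n = \sum_(i < m) fps_coef (F i) n.
Proof. by elim/big_ind2: _ => // f x g y <- <-. Qed.

Lemma coef_fpsCM (c : A) f n : fps_coef (fpsC c * f) n = c * fps_coef f n.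
Proof.
rewrite /= big_ord_recl /= subn0 big1 ?addr0 // => i _.
by rewrite mul0r.
Qed.

Lemma coef_fpsXM f n :
  fps_coef (fpsX * f) n = if n is m.+1 then fps_coef f m else 0.
Proof.
case: n => [|n] /=; first by rewrite big_ord1 mul0r.
rewrite big_ord_recl mul0r add0r big_ord_recl /= mul1r subSS subn0.
by rewrite big1 ?addr0 // => i _; rewrite mul0r.
Qed.

Lemma coef_fpsXnM m f n :
  fps_coef (fpsX ^+ m * f) n = if (m <= n)%N then fps_coef f (n - m) else 0.
Proof.
elim: m n => [|m IHm] n; first by rewrite expr0 mul1r subn0.
by rewrite exprS -mulrA coef_fpsXM; case: n => // n; rewrite IHm.
Qed.

Lemma fpsCM (a b : A) : fpsC (a * b) = fpsC a * fpsC b.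
Proof.
by apply: fpsP => n; rewrite coef_fpsCM /=; case: eqP => // _; rewrite mulr0.
Qed.

Lemma fpsCD (a b : A) : fpsC (a + b) = fpsC a + fpsC b.
Proof. by apply: fpsP => n /=; case: eqP => // _; rewrite addr0. Qed.

Lemma fpsCB (a b : A) : fpsC (a - b) = fpsC a - fpsC b.
Proof. by apply: fpsP => n /=; case: eqP => // _; rewrite subr0. Qed.

End FpsCoef.

(** * Generating functions of the limits *)

Section RhoSeries.
Variable R : realType.

Let inve : R := (expR 1)^-1.

Let dexp (a : R) : fps R := fps_dilate a (fps_exp R).

Lemma inve_expr n : inve ^+ n = expR (- n%:R).
Proof. by rewrite exprVn -expRM_natl mulr1 expRN. Qed.

(** The binomial theorem in each coefficient, with n! = C(n,i) i! (n-i)!. *)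
Lemma fps_expD a b : dexp a * dexp b = dexp (a + b).
Proof.
apply: fpsP => n /=; rewrite addrC exprDn mulr_suml; apply: eq_bigr => i _.
have le_in : (i <= n)%N by rewrite -ltnS.
have fact0 m : m`!%:R != 0 :> R by rewrite pnatr_eq0 -lt0n fact_gt0.
rewrite -mulr_natr -(bin_fact le_in) !natrM.
have bin0 : 'C(n, i)%:R != 0 :> R by rewrite pnatr_eq0 -lt0n bin_gt0.
by field; rewrite bin0 !fact0.
Qed.

Lemma fps_exp0 : dexp 0 = 1.
Proof.
apply: fpsP => -[|n] /=; first by rewrite expr0 fact0 invr1 mulr1.
by rewrite expr0n mul0r.
Qed.

(* Geometric expansion: 1/(E - x) = sum_m x^m E^-(m+1) for E = e^(x/e). *)
Lemma exp_sub_xM_geom M :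
  exp_sub_x R * (\sum_(m < M) fpsX ^+ m * dexp (- (m.+1%:R * inve))) =
  1 - fpsX ^+ M * dexp (- (M%:R * inve)).
Proof.
elim: M => [|M IHM].
  by rewrite big_ord0 mulr0 expr0 mul0r oppr0 fps_exp0 mulr1 subrr.
have expE : dexp inve * dexp (- (M.+1%:R * inve)) = dexp (- (M%:R * inve)).
  by rewrite fps_expD; congr dexp; rewrite -natr1; ring.
rewrite big_ord_recr /= mulrDr IHM -expE /exp_sub_x -/inve -/(dexp inve) exprS.
ring.
Qed.

Lemma coef_exp_sub_x_inv k : fps_coef (exp_sub_x R)^-1 k =
  \sum_(0 <= i < k.+1)
    (-1) ^+ i * (k + 1 - i)%:R ^+ i / i`!%:R * expR (- i%:R).
Proof.
(* The geometric sum is cut at M = k+1: the remainder is a multiple of x^(k+1) and does not reach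
   coefficient k. *)
have -> : (exp_sub_x R)^-1 =
    (\sum_(m < k.+1) fpsX ^+ m * dexp (- (m.+1%:R * inve))) +
    fpsX ^+ k.+1 * (dexp (- (k.+1%:R * inve)) * (exp_sub_x R)^-1).
  apply: (mulrI (exp_sub_x_unit R)).
  rewrite mulrV ?exp_sub_x_unit // mulrDr exp_sub_xM_geom.
  rewrite [X in _ + X]mulrC -!mulrA mulVr ?exp_sub_x_unit // mulr1.
  by rewrite subrK.
rewrite coef_fpsD coef_fpsXnM ltnn addr0 coef_fps_sum big_mkord.
(* Setting i = k-m, the m-th term contributes coefficient i of e^(-(m+1)x/e), with m+1 = k+1-i. *)
rewrite (reindex_inj rev_ord_inj); apply: eq_bigr => i _.
have le_ik : (i <= k)%N by rewrite -ltnS.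
rewrite coef_fpsXnM [rev_ord i : nat]/= subSS leq_subr subKn //= -inve_expr.
rewrite (_ : (k - i).+1 = (k + 1 - i)%N); last by lia.
by rewrite -mulNr exprMn -[- _%:R]mulN1r exprMn; ring.
Qed.

(** In positive degree the coefficients of the product vanish by [rho_rec]; degree 0 leaves the
    initial value. *)
Lemma exp_sub_xM_rho_gf l : (0 < l)%N ->
  exp_sub_x R * rho_gf R l = fpsC (rho R l 0).
Proof.
move=> l_gt0; apply: fpsP => k.
rewrite /exp_sub_x mulrBl coef_fpsB coef_fpsXM /= big_ord_recl /=.
rewrite expr0 mul1r fact0 invr1 mul1r subn0.
case: k => [|k]; first by rewrite big_ord0 addr0 subr0.
rewrite rho_rec // subn1 /= -(big_mkord xpredT (fun i => inve ^+ bump 0 i *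
  (bump 0 i)`!%:R^-1 * rho R l (k.+1 - bump 0 i))).
rewrite big_add1 /=.
under [X in _ - X + _]eq_bigr do rewrite -inve_expr.
by rewrite subrK subrr.
Qed.

Lemma rho_gfE l : (0 < l)%N ->
  rho_gf R l = fpsC (rho R l 0) * (exp_sub_x R)^-1.
Proof.
move=> l_gt0; rewrite -exp_sub_xM_rho_gf // mulrC mulKr //.
exact: exp_sub_x_unit.
Qed.

Lemma rhoE l k : (0 < l)%N -> rho R l k = rho R l 0 *
  \sum_(0 <= i < k.+1)
    (-1) ^+ i * (k + 1 - i)%:R ^+ i / i`!%:R * expR (- i%:R).
Proof.
move=> l_gt0; rewrite -coef_exp_sub_x_inv -coef_fpsCM -rho_gfE //.
Qed.

Lemma rho_gf2E : rho_gf2 R =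
  (fpsC (fpsC inve) * fpsX ^+ 2 * fps_lift (fps_dilate inve (fps_P R))
     - 2%:R * fpsX) / ((fpsX - 1) * fpsC (exp_sub_x R)).
Proof.
(* The factor 1/(e^(x/e)-x) is common to all l, so the claim reduces to y*[rho0] - [rho0] being the
   numerator. *)
pose rho0 : fps (fps R) :=
  Fps (fun l => if l == 0%N then 0 else fpsC (rho R l 0)).
have -> : rho_gf2 R = fpsC (exp_sub_x R)^-1 * rho0.
  apply: fpsP => l; rewrite coef_fpsCM /=.
  by case: eqP => [_ | /eqP l0]; rewrite ?mulr0 // rho_gfE ?lt0n // mulrC.
apply: (mulIr (rho_gf2_denom_unit R)).
rewrite divrK ?rho_gf2_denom_unit //.
have -> : fpsC (exp_sub_x R)^-1 * rho0 * ((fpsX - 1) * fpsC (exp_sub_x R)) =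
    fpsC ((exp_sub_x R)^-1 * exp_sub_x R) * (fpsX * rho0 - rho0).
  by rewrite fpsCM; ring.
rewrite mulVr ?exp_sub_x_unit // [fpsC 1]/(1 : fps (fps R)) mul1r.
have -> : fpsC (fpsC inve) * fpsX ^+ 2 * fps_lift (fps_dilate inve (fps_P R))
    - 2%:R * fpsX =
    fpsX * (fpsX * (fpsC (fpsC inve) * fps_lift (fps_dilate inve (fps_P R)))
      - fpsC (fpsC 2)).
  have -> : fpsC (fpsC 2) = 2%:R :> fps (fps R).
    by rewrite -[2 in LHS]/(1 + 1) !fpsCD.
  ring.
(* Coefficients of y: degree 0 is zero, degree 1 is the value 2 at l = 1, and degree l+2 is
   [rho0_diff]. *)
apply: fpsP => -[|l]; rewrite coef_fpsB !coef_fpsXM; first by rewrite subr0.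
case: l => [|l]; rewrite coef_fpsB coef_fpsXM.
  by rewrite /= rho10.
rewrite coef_fpsCM /= -fpsCM subr0 -fpsCB; congr fpsC.
rewrite rho0_diff opprB addrC subrK -inve_expr exprS; ring.
Qed.

End RhoSeries.

Theorem theorem4p4 (R : realType) :
  [/\ forall l k : nat, (1 <= l)%N -> cvgn (@rho_seq R l k),
      forall l k : nat, (1 <= l)%N -> (1 <= k)%N ->
        rho R l k = rho R l (k - 1)
          - \sum_(1 <= i < k.+1) expR (- i%:R) / i`!%:R * rho R l (k - i),
      forall l k : nat, (1 <= l)%N ->
        rho R l k = rho R l 0 *
          \sum_(0 <= i < k.+1)
            (-1) ^+ i * (k + 1 - i)%:R ^+ i / i`!%:R * expR (- i%:R),
      forall l : nat, (1 <= l)%N ->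
        rho_gf R l = fpsC (rho R l 0) * (exp_sub_x R)^-1
    & rho_gf2 R =
        (fpsC (fpsC (expR 1)^-1) * fpsX ^+ 2
            * fps_lift (fps_dilate (expR 1)^-1 (fps_P R))
          - 2%:R * fpsX)
        / ((fpsX - 1) * fpsC (exp_sub_x R)) ].
Proof.
split.
- exact: is_cvg_rho_seq.
- exact: rho_rec.
- exact: rhoE.
- exact: rho_gfE.
- exact: rho_gf2E.
Qed.
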